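(* Let $G\in\mathbb{C}^{n\times n}$ be a nonsingular Hermitian matrix, $G=G^*$, with inertia $(n-q,q)$ (that is, $n-q$ positive and $q$ negative eigenvalues, counted with multiplicity), and let $A\in\mathbb{C}^{n\times n}$ satisfy $A^*G=GA$. If $\sigma(A)\subset\{z\in\mathbb{C}:|z|\le1\}$, then $$\mathcal{M}_{|G|}(A)\le e\min\{d(A),\,2q+1,\,2(n-q)+1\}\,\mathcal{K}_{|G|}(A).$$ If $\rho(A)<\gamma<1$, then, for every integer $k\ge1$, $$\|A^k\|_{|G|}\le\min\{d(A),\,2q+1,\,2(n-q)+1\}\left(1+\frac1k\right)^k\mathcal{K}_{\gamma,|G|}(A)\,\gamma^k.$$ In particular, $$\|A^k\|_{|G|}\le e\min\{d(A),\,2q+1,\,2(n-q)+1\}\,\mathcal{K}_{\gamma,|G|}(A)\,\gamma^k.$$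
   Context: $\sigma(A)$ and $\rho(A)$ are the spectrum and spectral radius of $A$, and $d(A)$ is the degree of the minimal polynomial of $A$. Writing $G=U\operatorname{diag}(\lambda_1,\ldots,\lambda_n)U^*$ with $U$ unitary and $\lambda_j$ real and nonzero, set $|G|:=U\operatorname{diag}(|\lambda_1|,\ldots,|\lambda_n|)U^*$ and $R:=|G|^{1/2}$ (positive definite square root). Define the weighted norm $\|x\|_{|G|}:=\|Rx\|_2$ on $\mathbb{C}^n$, where $\|\cdot\|_2$ is the Euclidean norm, and the induced operator norm $\|T\|_{|G|}:=\sup_{x\ne0}\|Tx\|_{|G|}/\|x\|_{|G|}=\|RTR^{-1}\|_2$ (the last being the spectral norm). Define $$\mathcal{M}_{|G|}(A):=\sup_{k\ge0}\|A^k\|_{|G|},\qquad \mathcal{K}_{|G|}(A):=\sup_{|z|>1}(|z|-1)\|(zI-A)^{-1}\|_{|G|},$$ and, if $\rho(A)<\gamma$, $$\mathcal{K}_{\gamma,|G|}(A):=\sup_{|z|>\gamma}(|z|-\gamma)\|(zI-A)^{-1}\|_{|G|}.$$ $\mathcal{M}_{|G|}(A)$ and $\mathcal{K}_{|G|}(A)$ may equal $+\infty$, and inequalities are understood in the extended sense. *)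

(* Defs.v *)
From HB Require Import structures.
From mathcomp Require Import all_boot all_order all_algebra.
From mathcomp Require Import complex.
From mathcomp Require Import classical_sets reals ereal.
Import Order.TTheory GRing.Theory Num.Theory.
Import ComplexField.

Set Implicit Arguments.
Unset Strict Implicit.
Unset Printing Implicit Defensive.

Local Open Scope classical_set_scope.
Local Open Scope ring_scope.
Local Open Scope complex_scope.
Local Open Scope sesquilinear_scope.

Section HermitianCalculus.
Variables (C : numClosedFieldType) (n : nat).
Implicit Type H : 'M[C]_n.

(* [spectralmx H] is unitary and, for Hermitian H, diagonalizes H as
   H = U *m diag_mx (spectral_diag H) *m U^t* with U = (spectralmx H)^t*;
   the result does not depend on the chosen diagonalization. *)
Definition hermfun (f : C -> C) H : 'M[C]_n :=
  (spectralmx H)^t* *m diag_mx (map_mx f (spectral_diag H)) *m spectralmx H.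

Definition absmx H : 'M[C]_n := hermfun (fun x => `|x|) H.

Definition sqrtmx H : 'M[C]_n := hermfun sqrtC H.

(* The eigenvalues of a Hermitian H, with multiplicity, are the entries of
   [spectral_diag H]; the order on C only relates numbers whose difference is
   real, so [0 < x] and [x < 0] mean real positive and real negative. *)
Definition inertia H : nat * nat :=
  (#|[set i | 0 < spectral_diag H 0 i]%SET|,
   #|[set i | spectral_diag H 0 i < 0]%SET|).

End HermitianCalculus.

Section Norms.
Variables (R : realType) (n : nat).
Implicit Types (x : 'cV[R[i]]_n) (G T A : 'M[R[i]]_n).

Definition norm2 x : R := Num.sqrt (\sum_i Normc.normc (x i 0) ^+ 2).

Definition wnorm G x : R := norm2 (sqrtmx (absmx G) *m x).

Definition wopnorm G T : \bar R :=
  ereal_sup [set (wnorm G (T *m x) / wnorm G x)%:E | x in [set x | x != 0]].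

Definition spectrum A : set R[i] := [set z | eigenvalue A z].

Definition spectral_radius A : R := sup [set Normc.normc z | z in spectrum A].

Definition kreiss_at (gamma : R) G A : \bar R :=
  ereal_sup [set ((Normc.normc z - gamma)%:E * wopnorm G (invmx (z%:M - A)))%E
            | z in [set z : R[i] | gamma < Normc.normc z]].

Definition kreiss G A : \bar R := kreiss_at 1 G A.

End Norms.

Definition power_bound (R : realType) (n : nat) (G A : 'M[R[i]]_n.+1) : \bar R :=
  ereal_sup [set wopnorm G (A ^+ k) | k in [set: nat]].

Definition minpoly_degree (F : fieldType) (n : nat) (A : 'M[F]_n.+1) : nat :=
  (size (mxminpoly A)).-1.

(* Main.v *)
(* A congruence turns [G] into a signature matrix [J = diag (+-1)], the weighted
   norm into the Euclidean one and [A] into [B] with [J B] Hermitian. After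
   scaling to [D = B / rho], put [h k = v^* J D^k v]; as [J D^k] is Hermitian,
   bounds on [|h k|] for all unit [v] bound the norm of [D^k].
   The identity [(k + 1) h k = \sum_(i <= k) h (i + (k - i))] reads [(k + 1) h k]
   as a trace of the Hankel matrix [H = (h (i + j))] against a permutation, so it
   is at most the trace norm of [H]. The operator norm of [H] is bounded by the
   resolvent on the circle (finite Fourier transform), and so is [|\tr H|], which
   is half the sum of the symbol at [1] and [-1]. Since [H = Y^* J Y] has at most
   as many negative (positive) eigenvalues as [J], and rank at most the degree of
   the minimal polynomial, its trace norm is at most
   [min (d, 2 #neg + 1, 2 #pos + 1)] times that bound. For an [m x m] section of
   [H] the error is a multiple of the norm of [D^(2m) v], which tends to [0].
   Finally [rho = gamma (1 + 1/k)]. *)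
Require Import Defs.
From mathcomp Require Import all_boot all_order all_algebra.
From mathcomp Require Import complex.
From mathcomp Require Import classical_sets reals ereal sequences exp.
From mathcomp Require Import filter topology normedtype.
From mathcomp Require Import separable cyclotomic cyclic ring zify.
Import Order.TTheory GRing.Theory Num.Theory.

Set Implicit Arguments.
Unset Strict Implicit.
Unset Printing Implicit Defensive.

Local Open Scope classical_set_scope.
Local Open Scope ring_scope.
Local Open Scope sesquilinear_scope.

(** * Euclidean norm of column vectors over a closed numeric field *)

Section EuclideanNorm.
Context {C : numClosedFieldType}.

(** Valued in [C] itself, so that all the linear algebra stays in one field; [norm2E] ties it to the
    real-valued norm. *)
Definition vnorm n (x : 'cV[C]_n) : C := sqrtC (\sum_i `|x i 0| ^+ 2).

Lemma vnorm_sqr n (x : 'cV[C]_n) : vnorm x ^+ 2 = \sum_i `|x i 0| ^+ 2.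
Proof. exact: sqrtCK. Qed.

Lemma vnorm_ge0 n (x : 'cV[C]_n) : 0 <= vnorm x.
Proof. by rewrite sqrtC_ge0 sumr_ge0 // => i _; rewrite exprn_ge0. Qed.

Lemma vnorm_form n (x : 'cV[C]_n) : vnorm x ^+ 2 = (x^t* *m x) 0 0.
Proof.
by rewrite vnorm_sqr mxE; apply: eq_bigr => i _; rewrite !mxE normCKC.
Qed.

(** Links to the inner product of row vectors, from which the triangle and Cauchy-Schwarz
    inequalities are inherited. *)
Lemma vnorm_dotmx n (x : 'cV[C]_n) : vnorm x = sqrtC (dotmx x^T x^T).
Proof.
congr sqrtC; rewrite dotmxE mxE; apply: eq_bigr => i _.
by rewrite !mxE normCK.
Qed.

Lemma vnormD n (x y : 'cV[C]_n) : vnorm (x + y) <= vnorm x + vnorm y.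
Proof.
by rewrite !vnorm_dotmx linearD /= (triangle_lerif (@dotmx C n) x^T y^T).
Qed.

Lemma vnormZ n a (x : 'cV[C]_n) : vnorm (a *: x) = `|a| * vnorm x.
Proof.
apply/eqP; rewrite -(@eqrXn2 _ 2) ?mulr_ge0 ?vnorm_ge0 // exprMn !vnorm_sqr.
by rewrite mulr_sumr; apply/eqP/eq_bigr => i _; rewrite mxE normrM exprMn.
Qed.

Lemma vnormN n (x : 'cV[C]_n) : vnorm (- x) = vnorm x.
Proof. by rewrite -scaleN1r vnormZ normrN1 mul1r. Qed.

Lemma vnorm0 n : vnorm (0 : 'cV[C]_n) = 0.
Proof. by rewrite -(scale0r 0) vnormZ normr0 mul0r. Qed.

Lemma vnorm_eq0 n (x : 'cV[C]_n) : (vnorm x == 0) = (x == 0).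
Proof.
apply/idP/eqP => [/eqP x0 | ->]; last by rewrite vnorm0.
have /eqP := vnorm_sqr x; rewrite x0 expr0n /= eq_sym psumr_eq0; last first.
  by move=> i _; rewrite exprn_ge0.
move=> /allP xi0; apply/colP => i; rewrite mxE.
by have := xi0 i (mem_index_enum i); rewrite sqrf_eq0 normr_eq0 => /eqP.
Qed.

Lemma form_le_vnorm n (x y : 'cV[C]_n) :
  `|(x^t* *m y) 0 0| <= vnorm x * vnorm y.
Proof.
have <- : dotmx y^T x^T = (x^t* *m y) 0 0.
  by rewrite dotmxE !mxE; apply: eq_bigr => i _; rewrite !mxE mulrC.
rewrite !vnorm_dotmx mulrC.
exact: (CauchySchwarz_sqrt (@dotmx C n) y^T x^T).
Qed.

Lemma vnorm_unitary m n (V : 'M[C]_(m, n)) (x : 'cV_n) :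
  V^t* *m V = 1%:M -> vnorm (V *m x) = vnorm x.
Proof.
move=> VV; apply/eqP; rewrite -(@eqrXn2 _ 2) ?vnorm_ge0 // !vnorm_form.
by rewrite trmx_mul map_mxM mulmxA -(mulmxA (x^t*)) VV mulmx1.
Qed.

End EuclideanNorm.

(** * Spectral decomposition of Hermitian matrices *)

Section HermitianSpectrum.
Context {C : numClosedFieldType}.

Lemma mulr_le_mean_sqr (a b : C) : 0 <= a -> 0 <= b ->
  a * b <= (a ^+ 2 + b ^+ 2) / 2.
Proof.
move=> a0 b0; rewrite ler_pdivlMr ?ltr0n // -subr_ge0.
rewrite [X in 0 <= X](_ : _ = (a - b) ^+ 2); last by rewrite sqrrB; ring.
by rewrite -realEsqr rpredB ?ger0_real.
Qed.

Lemma hermitianP n (H : 'M[C]_n) : H^t* = H -> H \is hermsymmx.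
Proof. by move=> HH; apply/is_hermitianmxP; rewrite expr0 scale1r HH. Qed.

Lemma spectralmx_adjK n (H : 'M[C]_n) :
  (spectralmx H)^t* *m spectralmx H = 1%:M.
Proof.
by rewrite -(invmx_unitary (spectral_unitarymx H)) mulVmx ?spectral_unit.
Qed.

Lemma spectralmx_Kadj n (H : 'M[C]_n) :
  spectralmx H *m (spectralmx H)^t* = 1%:M.
Proof. exact/unitarymxP/spectral_unitarymx. Qed.

Lemma hermitian_spectral n (H : 'M[C]_n) : H^t* = H ->
  H = (spectralmx H)^t* *m diag_mx (spectral_diag H) *m spectralmx H.
Proof.
move=> /hermitianP/hermitian_normalmx/orthomx_spectralP {1}->.
by rewrite invmx_unitary ?spectral_unitarymx.
Qed.

Lemma spectral_diag_real n (H : 'M[C]_n) l : H^t* = H ->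
  spectral_diag H 0 l \is Num.real.
Proof. by move=> /hermitianP/hermitian_spectral_diag_real/mxOverP. Qed.

Lemma diag_form m (d : 'rV[C]_m) (y : 'cV_m) :
  (y^t* *m diag_mx d *m y) 0 0 = \sum_l d 0 l * `|y l 0| ^+ 2.
Proof.
rewrite -mulmxA mxE; apply: eq_bigr => l _.
by rewrite mul_diag_mx !mxE mulrCA normCKC.
Qed.

Lemma spectral_form n (H : 'M[C]_n) (x : 'cV_n) : H^t* = H ->
  (x^t* *m H *m x) 0 0 =
  \sum_l spectral_diag H 0 l * `|(spectralmx H *m x) l 0| ^+ 2.
Proof.
move=> /hermitian_spectral HE; rewrite -diag_form {1}HE.
by rewrite trmx_mul map_mxM !mulmxA.
Qed.

Lemma spectral_eigen_form n (H : 'M[C]_n) l : H^t* = H ->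
  exists2 x : 'cV_n, vnorm x = 1 & (x^t* *m H *m x) 0 0 = spectral_diag H 0 l.
Proof.
move=> HH; exists ((spectralmx H)^t* *m delta_mx l 0).
  apply/eqP; rewrite -(@eqrXn2 _ 2) ?vnorm_ge0 ?ler01 // expr1n.
  rewrite vnorm_unitary; last by rewrite trmxCK spectralmx_Kadj.
  rewrite vnorm_sqr (bigD1 l) //= big1 => [|i il].
    by rewrite mxE !eqxx normr1 expr1n addr0.
  by rewrite mxE (negbTE il) normr0 expr0n.
rewrite spectral_form // mulmxA spectralmx_Kadj mul1mx (bigD1 l) //= big1.
  by rewrite mxE !eqxx normr1 expr1n addr0 mulr1.
by move=> i il; rewrite mxE (negbTE il) normr0 expr0n mulr0.
Qed.

Lemma spectral_diag_le n (H : 'M[C]_n) (b : C) l : H^t* = H ->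
  (forall x : 'cV_n, `|(x^t* *m H *m x) 0 0| <= b * vnorm x ^+ 2) ->
  `|spectral_diag H 0 l| <= b.
Proof.
move=> HH Hb; have [x x1 <-] := spectral_eigen_form l HH.
by have := Hb x; rewrite x1 expr1n mulr1.
Qed.

(** In an orthonormal eigenbasis the bound on the form limits every eigenvalue, and the eigenvalues
    limit the norm. *)
Lemma hermitian_vnorm_le n (H : 'M[C]_n) (b : C) : H^t* = H -> 0 <= b ->
  (forall x : 'cV_n, `|(x^t* *m H *m x) 0 0| <= b * vnorm x ^+ 2) ->
  forall x : 'cV_n, vnorm (H *m x) <= b * vnorm x.
Proof.
move=> HH b0 Hb x.
rewrite -(@ler_pXn2r _ 2) ?nnegrE ?mulr_ge0 ?vnorm_ge0 // exprMn.
rewrite -[in leRHS](vnorm_unitary x (spectralmx_adjK H)).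
rewrite {1}(hermitian_spectral HH) -!mulmxA vnorm_unitary; last first.
  by rewrite trmxCK spectralmx_Kadj.
rewrite !vnorm_sqr mulr_sumr; apply: ler_sum => l _.
rewrite mul_diag_mx mxE normrM exprMn ler_wpM2r ?exprn_ge0 //.
by rewrite ler_pXn2r ?nnegrE // spectral_diag_le.
Qed.

Lemma spectral_diag_trace n (H : 'M[C]_n) : H^t* = H ->
  \sum_l spectral_diag H 0 l = \tr H.
Proof.
move=> HH; rewrite {2}(hermitian_spectral HH) mxtrace_mulC mulmxA.
by rewrite spectralmx_Kadj mul1mx mxtrace_diag.
Qed.

(** Trace-norm duality against a partial permutation matrix: each eigenvalue gets multiplied by the
    pairing of a unit eigenvector with its permuted copy, of modulus at most 1. *)
Lemma hermitian_pairing_le n (H : 'M[C]_n) (P : pred 'I_n) (s : 'I_n -> 'I_n) :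
  H^t* = H -> injective s ->
  `|\sum_(i | P i) H i (s i)| <= \sum_l `|spectral_diag H 0 l|.
Proof.
move=> HH s_inj; set V := spectralmx H; set d := spectral_diag H.
have row1 l : \sum_i `|V l i| ^+ 2 = 1.
  transitivity ((V *m V^t*) l l); last by rewrite spectralmx_Kadj mxE eqxx.
  by rewrite mxE; apply: eq_bigr => i _; rewrite !mxE normCK.
have -> : \sum_(i | P i) H i (s i) =
    \sum_l d 0 l * \sum_(i | P i) (V l i)^* * V l (s i).
  under [RHS]eq_bigr => l _ do rewrite mulr_sumr.
  rewrite exchange_big /=; apply: eq_bigr => i _.
  rewrite {1}(hermitian_spectral HH) -mulmxA mxE; apply: eq_bigr => l _.
  by rewrite mul_diag_mx !mxE mulrCA.
apply: le_trans (ler_norm_sum _ _ _) _; apply: ler_sum => l _.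
rewrite normrM -[leRHS]mulr1 ler_wpM2l //.
apply: le_trans (ler_norm_sum _ _ _) _.
(* The arithmetic-geometric mean inequality separates the two factors. After summation over all [i],
   injectivity of [s] turns each part into half the squared norm of a unit row. *)
apply: (@le_trans _ _
  (\sum_(i | P i) (`|V l i| ^+ 2 + `|V l (s i)| ^+ 2) / 2)).
  by apply: ler_sum => i _; rewrite normrM norm_conjC mulr_le_mean_sqr.
apply: (@le_trans _ _ (\sum_i (`|V l i| ^+ 2 + `|V l (s i)| ^+ 2) / 2)).
  by rewrite [leRHS](bigID P) /= lerDl sumr_ge0.
rewrite -mulr_suml big_split /= row1.
rewrite -(reindex_inj s_inj (P := predT) (F := fun i => `|V l i| ^+ 2)) /=.
by rewrite row1 -[1 + 1]/(2%:R) divff ?pnatr_eq0.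
Qed.

End HermitianSpectrum.

(** * Counting eigenvalues and bounding the trace norm *)

Section EigenvalueCount.
Context {C : numClosedFieldType}.

(** If [S] had more than [r] indices, the [r] equations of [L] would have a nonzero solution among
    the vectors whose [V]-coordinates are supported in [S]. *)
Lemma card_le_of_trivial_kernel m r (V : 'M[C]_m) (L : 'M_(r, m))
    (S : {set 'I_m}) : V *m V^t* = 1%:M ->
  (forall x : 'cV_m, L *m x = 0 -> (forall l, l \notin S -> (V *m x) l 0 = 0) ->
     V *m x = 0) ->
  (#|S| <= r)%N.
Proof.
move=> VV kerL; rewrite leqNgt; apply/negP => r_lt.
pose E : 'M[C]_(#|S|, m) := \matrix_(j, l) (enum_val j == l)%:R.
pose M := (L *m V^t* *m E^T)^T.
(* [M] has [#|S|] rows and only [r] columns, hence a nonzero left kernel vector [c], which [E]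
   spreads over the indices of [S]. *)
have /rowV0Pn[c /sub_kermxP cM c0] : kermx M != 0.
  rewrite -mxrank_eq0 mxrank_ker subn_eq0 -ltnNge.
  exact: leq_ltn_trans (rank_leq_col M) r_lt.
pose y := (c *m E)^T.
have yE l : y l 0 = \sum_j c 0 j * (enum_val j == l)%:R.
  by rewrite !mxE; apply: eq_bigr => j _; rewrite mxE.
have VVy : V *m (V^t* *m y) = y by rewrite mulmxA VV mul1mx.
have y0 : y = 0.
  rewrite -VVy; apply: kerL => [|l lS].
    rewrite /y trmx_mul !mulmxA -[LHS]trmxK.
    by rewrite trmx_mul trmxK -/M cM trmx0.
  rewrite VVy yE big1 // => j _; case: eqP => [jl|_]; last by rewrite mulr0.
  by move: lS; rewrite -jl enum_valP.
case/eqP: c0; apply/rowP => j; rewrite [RHS]mxE.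
have := yE (enum_val j); rewrite y0 mxE (bigD1 j) //= eqxx mulr1 big1.
  by rewrite addr0.
by move=> i ij; rewrite (inj_eq enum_val_inj) (negbTE ij) mulr0.
Qed.

(** The kernel of [W] lies in that of [H], which meets the span of the eigenvectors for nonzero
    eigenvalues only in 0. *)
Lemma card_spectral_neq0 m r (H : 'M[C]_m) (Z : 'M_(m, r)) (W : 'M_(r, m)) :
  H^t* = H -> H = Z *m W ->
  (#|[set l | (spectral_diag H 0 l != 0)%R]%SET| <= r)%N.
Proof.
move=> HH HZW.
apply: (card_le_of_trivial_kernel (L := W)) (spectralmx_Kadj H) _ => x Wx Sx.
apply/colP => l; rewrite [RHS]mxE.
have [|lS] := boolP (l \in [set l | spectral_diag H 0 l != 0]%SET);
  last exact: Sx.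
rewrite inE => d0; apply: (mulfI d0); rewrite mulr0.
have : spectralmx H *m (H *m x) = 0 by rewrite {2}HZW -mulmxA Wx !mulmx0.
rewrite {2}(hermitian_spectral HH) -!mulmxA mulmxA spectralmx_Kadj mul1mx.
by move=> /colP/(_ l); rewrite mul_diag_mx !mxE.
Qed.

(* [s = 1] counts negative eigenvalues and [s = -1] positive ones. *)
Lemma card_spectral_neg m n (s : C) (H : 'M[C]_m) (d : 'rV[C]_n)
    (Y : 'M_(n, m)) :
  H^t* = H -> H = Y^t* *m diag_mx d *m Y -> s \is Num.real ->
  (forall i, d 0 i \is Num.real) ->
  (#|[set l | (s * spectral_diag H 0 l < 0)%R]%SET| <=
   #|[set i | (s * d 0 i < 0)%R]%SET|)%N.
Proof.
move=> HH HY sR dR; set S := [set l | _]%SET; set Sd := [set i | _]%SET.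
pose L : 'M[C]_(#|Sd|, m) := \matrix_(j, l) Y (enum_val j) l.
apply: (card_le_of_trivial_kernel (L := L)) (spectralmx_Kadj H) _ => x Lx Sx.
have Yx i : i \in Sd -> (Y *m x) i 0 = 0.
  move=> iS; transitivity ((L *m x) (enum_rank_in iS i) 0).
    by rewrite !mxE; apply: eq_bigr => j _; rewrite mxE enum_rankK_in.
  by rewrite Lx mxE.
(* [L x = 0] kills the coordinates of [Y x] where [s d] is negative, so the form is nonnegative; as
   [x] is supported on the negative eigenvalues of [s H], it is also nonpositive, and every term
   vanishes. *)
have dge : 0 <= s * (x^t* *m H *m x) 0 0.
  have -> : x^t* *m H *m x = (Y *m x)^t* *m diag_mx d *m (Y *m x).
    by rewrite HY trmx_mul map_mxM !mulmxA.
  rewrite diag_form mulr_sumr sumr_ge0 // => i _; rewrite mulrA.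
  have [iS|iS] := boolP (i \in Sd); first by rewrite Yx // normr0 expr0n mulr0.
  rewrite mulr_ge0 ?exprn_ge0 //; move: iS; rewrite inE.
  by rewrite -real_leNgt ?rpredM ?rpred0.
move: dge; rewrite spectral_form // mulr_sumr => dge.
pose F l := - (s * (spectral_diag H 0 l * `|(spectralmx H *m x) l 0| ^+ 2)).
have F0 l : 0 <= F l.
  rewrite oppr_ge0 mulrA.
  have [|lS] := boolP (l \in S); last by rewrite Sx // normr0 expr0n mulr0.
  by rewrite inE => /ltW sl; rewrite mulr_le0_ge0 ?exprn_ge0.
have sF : \sum_l F l = 0.
  by apply: le_anti; rewrite sumr_ge0 // andbT sumrN oppr_le0.
apply/colP => l; rewrite [RHS]mxE.
have [lS|lS] := boolP (l \in S); last exact: Sx.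
have /eqP := sF; rewrite psumr_eq0 // => /allP/(_ l (mem_index_enum l)) /=.
rewrite oppr_eq0 mulrA mulf_eq0 => /orP[/eqP sl|].
  by move: lS; rewrite inE sl ltxx.
by rewrite sqrf_eq0 normr_eq0 => /eqP.
Qed.

Lemma spectral_sum_le_rank m r (H : 'M[C]_m) (b : C) : 0 <= b ->
  (forall l, `|spectral_diag H 0 l| <= b) ->
  (#|[set l | (spectral_diag H 0 l != 0)%R]%SET| <= r)%N ->
  \sum_l `|spectral_diag H 0 l| <= r%:R * b.
Proof.
move=> b0 Hb Sr; set S := [set l | _]%SET in Sr.
rewrite (bigID (mem S)) /= [X in _ + X]big1 ?addr0; last first.
  by move=> l; rewrite inE negbK => /eqP->; rewrite normr0.
apply: (@le_trans _ _ (\sum_(l in S) b)); first exact: ler_sum.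
by rewrite sumr_const -[leLHS]mulr_natl ler_wpM2r ?ler_nat.
Qed.

(** An eigenvalue [l] has [|l| = s l], plus [2 |l|] when [s l] is negative. The sum is thus [s]
    times the trace plus at most [q] terms of size [2 b], whence the factor [2 q + 1]. *)
Lemma spectral_sum_le_inertia m q (s : C) (H : 'M[C]_m) (b : C) :
  H^t* = H -> s \is Num.real -> `|s| = 1 -> `|\tr H| <= b ->
  (forall l, `|spectral_diag H 0 l| <= b) ->
  (#|[set l | (s * spectral_diag H 0 l < 0)%R]%SET| <= q)%N ->
  \sum_l `|spectral_diag H 0 l| <= (2 * q + 1)%:R * b.
Proof.
move=> HH sR s1 trb Hb Sq; set S := [set l | _]%SET in Sq.
have b0 : 0 <= b := le_trans (normr_ge0 _) trb.
have lR l : s * spectral_diag H 0 l \is Num.real.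
  by rewrite rpredM // spectral_diag_real.
have sl l : `|spectral_diag H 0 l| = `|s * spectral_diag H 0 l|.
  by rewrite normrM s1 mul1r.
have -> : \sum_l `|spectral_diag H 0 l| =
    s * \tr H + \sum_(l in S) 2 * `|spectral_diag H 0 l|.
  rewrite -spectral_diag_trace // mulr_sumr.
  rewrite [X in _ + X](big_mkcond (mem S)) -big_split /=.
  apply: eq_bigr => l _; rewrite inE sl; case: ifP => [l0|/negbT].
    by rewrite ltr0_norm //; ring.
  by rewrite -real_leNgt ?rpred0 // => l0; rewrite ger0_norm // addr0.
rewrite natrD mulrDl mul1r addrC lerD //.
  apply: (@le_trans _ _ (\sum_(l in S) 2 * b)).
    by apply: ler_sum => l _; rewrite ler_wpM2l ?ler0n.
  rewrite sumr_const -[leLHS]mulr_natl mulrA ler_wpM2r // natrM mulrC.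
  by rewrite ler_wpM2l ?ler0n ?ler_nat.
apply: le_trans trb; rewrite -[leRHS]mul1r -s1 -normrM.
apply: real_ler_norm; rewrite rpredM // -spectral_diag_trace //.
by apply: rpred_sum => l _; apply: spectral_diag_real.
Qed.

End EigenvalueCount.

(** * Roots of unity, the finite Fourier transform and Hankel forms *)

Section RootsOfUnity.
Context {C : numClosedFieldType}.

(** [X^N - 1] splits and is separable in characteristic zero, so it has [N] distinct roots, and
    these form a cyclic group. *)
Lemma primitive_root_exists N : (0 < N)%N ->
  exists w : C, N.-primitive_root w.
Proof.
move=> N0; have [r] := closed_field_poly_normal ('X^N - 1 : {poly C}).
rewrite (monicP (monicXnsubC _ N0)) scale1r => Nr.
have /(has_prim_root N0) : all N.-unity_root r.
  by apply/allP => z; rewrite -root_prod_XsubC -Nr.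
case/(_ _ _)/hasP => [||w _ wN]; last by exists w.
- rewrite -separable_prod_XsubC -Nr separable_Xn_sub_1 // pnatr_eq0 -lt0n //.
- by rewrite -ltnS -(size_prod_XsubC r id) -Nr size_XnsubC.
Qed.

Lemma unity_root_norm N (z : C) : (0 < N)%N -> z ^+ N = 1 -> `|z| = 1.
Proof.
move=> N0 zN; apply: (pexpIrn N0); rewrite ?nnegrE ?ler01 //.
by rewrite -normrX zN normr1 expr1n.
Qed.

Lemma unit_conjM (z : C) : `|z| = 1 -> z * z^* = 1.
Proof. by move=> z1; rewrite -normCK z1 expr1n. Qed.

(** Orthogonality of characters: the sum is geometric, and its ratio [u] is an [N]-th root of unity
    that equals 1 only when [i = j]. *)
Lemma unity_root_ortho N (w : C) i j : N.-primitive_root w ->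
  (i < N)%N -> (j < N)%N ->
  \sum_(a < N) ((w ^+ a)^* ^+ i * (w ^+ a) ^+ j) = (N * (i == j))%:R.
Proof.
move=> wN iN jN; have N0 : (0 < N)%N := prim_order_gt0 wN.
have w1 := unit_conjM (unity_root_norm N0 (prim_expr_order wN)).
pose u := w^* ^+ i * w ^+ j.
have -> : \sum_(a < N) ((w ^+ a)^* ^+ i * (w ^+ a) ^+ j) = \sum_(a < N) u ^+ a.
  apply: eq_bigr => a _; rewrite exprMn rmorphXn -!exprM.
  by rewrite mulnC (mulnC j).
have uw : u * w ^+ i = w ^+ j.
  by rewrite /u mulrAC -exprMn mulrC (mulrC (w^*)) w1 expr1n mulr1.
have [ij|ij] := eqVneq i j.
  have -> : u = 1 by rewrite /u ij -exprMn mulrC w1 expr1n.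
  rewrite (eq_bigr (fun=> 1)) => [|a _]; rewrite ?expr1n //.
  by rewrite sumr_const card_ord muln1.
rewrite muln0; have u1 : u - 1 != 0.
  rewrite subr_eq0; apply: contraNneq ij => u1; move: uw; rewrite u1 mul1r.
  by move/eqP; rewrite (eq_prim_root_expr wN) !modn_small.
apply: (mulfI u1); rewrite mulr0 -subrX1 exprMn -!exprM.
rewrite (mulnC i) (mulnC j) !exprM -rmorphXn (prim_expr_order wN).
by rewrite rmorph1 !expr1n mulr1 subrr.
Qed.

Lemma parseval N m (w : C) (x : 'I_m -> C) :
  N.-primitive_root w -> (m <= N)%N ->
  \sum_(a < N) `|\sum_j x j * (w ^+ a) ^+ j| ^+ 2 = N%:R * \sum_j `|x j| ^+ 2.
Proof.
move=> wN mN.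
transitivity (\sum_(a < N) \sum_i \sum_j
    x j * (x i)^* * ((w ^+ a)^* ^+ i * (w ^+ a) ^+ j)).
  apply: eq_bigr => a _; rewrite normCK rmorph_sum mulr_sumr.
  apply: eq_bigr => i _; rewrite mulr_suml; apply: eq_bigr => j _.
  by rewrite rmorphM rmorphXn /=; ring.
rewrite exchange_big mulr_sumr /=; apply: eq_bigr => i _.
rewrite exchange_big /= (bigD1 i) //= [X in _ + X]big1 => [|j ji].
  rewrite -mulr_sumr unity_root_ortho ?(leq_trans (ltn_ord _)) // eqxx muln1.
  by rewrite normCK addr0 mulrC.
rewrite -mulr_sumr unity_root_ortho ?(leq_trans (ltn_ord _)) //.
by rewrite (inj_eq val_inj) eq_sym (negbTE ji) muln0 mulr0.
Qed.

(* The finite Hankel matrix [h (i + j)] is a corner of the flip of the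
   circulant matrix whose symbol [\sum_n h n * z ^- n] is bounded by [b]. *)
Lemma hankel_form_le N m (h : nat -> C) (b : C) (x : 'I_m -> C) :
  (0 < N)%N -> (2 * m <= N.+1)%N ->
  (forall z : C, z ^+ N = 1 -> `|\sum_(n < N) z^* ^+ n * h n| <= b) ->
  `|\sum_(i < m) \sum_(j < m) (x i)^* * h (i + j)%N * x j|
    <= b * \sum_j `|x j| ^+ 2.
Proof.
move=> N0 mN hb; have [w wN] := primitive_root_exists N0.
pose f (a : 'I_N) := \sum_(n < N) (w ^+ a)^* ^+ n * h n.
pose p (a : 'I_N) := \sum_i (x i)^* * (w ^+ a) ^+ i.
pose q (a : 'I_N) := \sum_j x j * (w ^+ a) ^+ j.
have m_le_N : (m <= N)%N by lia.
(* Fourier inversion recovers [h (i + j)] from the symbol values [f a]. It needs [i + j < N], which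
   is where [2 m <= N + 1] enters. *)
have NE : N%:R * (\sum_(i < m) \sum_(j < m) (x i)^* * h (i + j)%N * x j) =
    \sum_a f a * (p a * q a).
  rewrite mulr_sumr.
  transitivity (\sum_(i < m) \sum_(j < m) \sum_a
      (x i)^* * x j * (f a * (w ^+ a) ^+ (i + j)%N)).
    apply: eq_bigr => i _; rewrite mulr_sumr; apply: eq_bigr => j _.
    have ijN : (i + j < N)%N by have := ltn_ord i; have := ltn_ord j; lia.
    rewrite -mulr_sumr.
    have -> : \sum_a f a * (w ^+ a) ^+ (i + j)%N = N%:R * h (i + j)%N.
      under eq_bigr => a _ do rewrite mulr_suml.
      rewrite exchange_big /= (bigD1 (Ordinal ijN)) //= [X in _ + X]big1.
        rewrite addr0; under eq_bigr => a _ do rewrite mulrAC.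
        by rewrite -mulr_suml (unity_root_ortho wN) // eqxx muln1.
      move=> n nij; under eq_bigr => a _ do rewrite mulrAC.
      rewrite -mulr_suml (unity_root_ortho wN) //.
      by rewrite -(inj_eq val_inj) /= in nij; rewrite (negbTE nij) muln0 mul0r.
    by ring.
  under eq_bigr => i _ do rewrite exchange_big.
  rewrite exchange_big /=; apply: eq_bigr => a _.
  rewrite /p /q mulr_suml mulr_sumr; apply: eq_bigr => i _.
  rewrite mulr_sumr mulr_sumr; apply: eq_bigr => j _.
  by rewrite exprD; ring.
have NR : 0 < N%:R :> C by rewrite ltr0n.
rewrite -(ler_pM2l NR) -[X in X * `|_| <= _](ger0_norm (ltW NR)) -normrM NE.
apply: le_trans (ler_norm_sum _ _ _) _.
(* The mean inequality separates [p] from [q], and Parseval evaluates each. *)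
apply: (@le_trans _ _ (\sum_a b * ((`|p a| ^+ 2 + `|q a| ^+ 2) / 2))).
  apply: ler_sum => a _; rewrite normrM ler_pM ?normr_ge0 //.
    by apply: hb; rewrite exprAC (prim_expr_order wN) expr1n.
  by rewrite normrM mulr_le_mean_sqr.
rewrite -mulr_sumr -mulr_suml big_split /= !parseval //.
have -> : \sum_j `|(x j)^*| ^+ 2 = \sum_j `|x j| ^+ 2.
  by apply: eq_bigr => j _; rewrite norm_conjC.
by rewrite le_eqVlt; apply/orP; left; apply/eqP; field; rewrite ?pnatr_eq0.
Qed.

(** Twice the trace of a Hankel matrix is the sum of its symbol at [1] and at [-1], as the odd terms
    cancel. *)
Lemma sum_even_terms m (h : nat -> C) :
  2 * \sum_(i < m) h (i + i)%N =
  \sum_(n < 2 * m) h n + \sum_(n < 2 * m) (-1) ^+ n * h n.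
Proof.
rewrite mulr_sumr -big_split /=.
elim: m => [|m IHm]; first by rewrite muln0 !big_ord0.
rewrite mulnS !big_ord_recr /= IHm -addrA; congr (_ + _).
by rewrite addnn -mul2n exprS -signr_odd oddM /= expr0; ring.
Qed.

End RootsOfUnity.

(** * Moments of a matrix that is self-adjoint for an indefinite form *)

Section SelfadjointMoments.
Context {C : numClosedFieldType} (n : nat).
Variables (s : 'rV[C]_n.+1) (D : 'M[C]_n.+1) (M : C).
Let J := diag_mx s.
Hypothesis s_sign : forall i, s 0 i = 1 \/ s 0 i = -1.
Hypothesis JD : D^t* *m J = J *m D.
Hypothesis M_ge0 : 0 <= M.
Hypothesis resolvent_le : forall (z : C) (x : 'cV_n.+1),
  `|z| = 1 -> vnorm x <= M * vnorm (z *: x - D *m x).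

Let sC i : (s 0 i)^* = s 0 i.
Proof. by case: (s_sign i) => ->; rewrite ?rmorphN rmorph1. Qed.

Lemma signature_herm : J^t* = J.
Proof.
rewrite /J tr_diag_mx map_diag_mx; congr diag_mx.
by apply/rowP => i; rewrite mxE; exact: sC.
Qed.

Lemma signature_unitary : J^t* *m J = 1%:M.
Proof.
rewrite signature_herm; apply/matrixP => i j; rewrite mul_diag_mx !mxE.
case: eqP => _; last by rewrite mulr0n mulr0.
by rewrite !mulr1n; case: (s_sign i) => ->; rewrite ?mulrNN mulr1.
Qed.

Lemma selfadjoint_expr k : (D ^+ k)^t* *m J = J *m D ^+ k.
Proof.
elim: k => [|k IHk]; first by rewrite expr0 trmx1 map_mx1 mul1mx mulmx1.
rewrite {1}exprS trmx_mul map_mxM -mulmxA JD mulmxA IHk -mulmxA.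
by rewrite exprSr.
Qed.

Variable v : 'cV[C]_n.+1.

Definition moment k : C := (v^t* *m J *m D ^+ k *m v) 0 0.

(** The symbol pairs [J v] with the truncated Neumann series [y]. Applying [z - D] to [y] telescopes
    to [z (v - D^N v)], so the resolvent bound controls [y], and Cauchy-Schwarz concludes. *)
Lemma moment_symbol_le N (z : C) : (0 < N)%N -> z ^+ N = 1 ->
  `|\sum_(k < N) z^* ^+ k * moment k| <= M * vnorm v * vnorm (v - D ^+ N *m v).
Proof.
move=> N0 zN; have z1 := unity_root_norm N0 zN.
have zc := unit_conjM z1.
pose u k := z^* ^+ k *: (D ^+ k *m v); pose y := \sum_(k < N) u k.
have -> : \sum_(k < N) z^* ^+ k * moment k = ((J *m v)^t* *m y) 0 0.
  rewrite /y mulmx_sumr summxE; apply: eq_bigr => k _.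
  by rewrite -scalemxAr trmx_mul map_mxM signature_herm mulmxA mxE.
apply: le_trans (form_le_vnorm _ _) _.
rewrite (vnorm_unitary _ signature_unitary) -mulrA mulrCA ler_wpM2l ?vnorm_ge0 //.
have uS k : D *m u k = z *: u k.+1.
  rewrite /u -scalemxAr scalerA exprS mulrA zc mul1r exprS.
  by rewrite -[D * _]/(D *m _) mulmxA.
have -> : vnorm (v - D ^+ N *m v) = vnorm (z *: y - D *m y).
  have -> : z *: y - D *m y = z *: (v - D ^+ N *m v).
    rewrite /y mulmx_sumr scaler_sumr -sumrB.
    have -> : \sum_(k < N) (z *: u k - D *m u k) = z *: (u 0%N - u N).
      under eq_bigr => k _ do rewrite uS -scalerBr.
      rewrite -scaler_sumr; congr (_ *: _).
      rewrite -(big_mkord xpredT (fun k => u k - u k.+1)).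
      rewrite -[LHS]opprK -sumrN; under eq_bigr => k _ do rewrite opprB.
      by rewrite telescope_sumr // opprB.
    by rewrite /u expr0 scale1r expr0 mul1mx -rmorphXn zN rmorph1 scale1r.
  by rewrite vnormZ z1 mul1r.
exact: resolvent_le.
Qed.

Theorem moment_le r k m : (k < m)%N ->
  (forall j, exists a : 'I_r -> C, D ^+ j = \sum_t a t *: D ^+ t) ->
  k.+1%:R * `|moment k| <=
  (minn r (minn (2 * #|[set i | (s 0 i < 0)%R]%SET| + 1)
                (2 * #|[set i | (0 < s 0 i)%R]%SET| + 1)))%:R *
  (M * vnorm v * vnorm (v - D ^+ (2 * m) *m v)).
Proof.
move=> km span; set b := _ * vnorm _.
have N0 : (0 < 2 * m)%N by rewrite muln_gt0 /= (leq_trans _ km).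
have b0 : 0 <= b by rewrite !mulr_ge0 ?vnorm_ge0.
pose Y : 'M[C]_(n.+1, m) := \matrix_(i, j) (D ^+ j *m v) i 0.
(* The Gram matrix of [v, D v, D^2 v, ...] for the form [J]: the congruence controls its inertia,
   and self-adjointness of [D] makes it Hankel. *)
pose H : 'M[C]_m := Y^t* *m J *m Y.
have HE i j : H i j = moment (i + j).
  transitivity (((D ^+ i *m v)^t* *m (J *m (D ^+ j *m v))) 0 0).
    rewrite /H -mulmxA mxE [RHS]mxE; apply: eq_bigr => l _.
    by rewrite !mul_diag_mx !mxE.
  rewrite trmx_mul map_mxM !mulmxA -(mulmxA (v^t*)) selfadjoint_expr.
  by rewrite /moment mulmxA -(mulmxA _ (D ^+ i)) -[D ^+ i *m _]exprD.
have HH : H^t* = H.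
  rewrite /H !trmx_mul !map_mxM trmxCK signature_herm.
  by rewrite mulmxA.
have eigH l : `|spectral_diag H 0 l| <= b.
  apply: spectral_diag_le HH _ => x.
  have -> : (x^t* *m H *m x) 0 0 =
      \sum_(i < m) \sum_(j < m) (x i 0)^* * moment (i + j) * x j 0.
    rewrite mxE exchange_big /=; apply: eq_bigr => j _; rewrite mxE mulr_suml.
    by apply: eq_bigr => i _; rewrite HE !mxE.
  rewrite vnorm_sqr; apply: (@hankel_form_le _ (2 * m)%N) => //.
  by move=> z; apply: moment_symbol_le.
(* [N = 2 m] is even, so [-1] is an [N]-th root of unity and the symbol bound applies there as well
   as at [1]. *)
have trH : `|\tr H| <= b.
  have two0 : 0 < 2 :> C by rewrite ltr0n.
  rewrite -(ler_pM2l two0) -[X in X * `|_| <= _](ger0_norm (ltW two0)) -normrM.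
  rewrite /mxtrace; under eq_bigr => i _ do rewrite HE.
  rewrite sum_even_terms; apply: le_trans (ler_normD _ _) _.
  rewrite mulr_natl mulr2n lerD //.
    have := moment_symbol_le N0 (expr1n C (2 * m)).
    by rewrite rmorph1; under eq_bigr => i _ do rewrite expr1n mul1r.
  have := @moment_symbol_le _ (-1) N0; rewrite rmorphN rmorph1; apply.
  by rewrite exprM sqrrN !expr1n.
have sR i : s 0 i \is Num.real by case: (s_sign i) => ->; rewrite ?realN real1.
have sumH : \sum_l `|spectral_diag H 0 l| <=
    (minn r (minn (2 * #|[set i | (s 0 i < 0)%R]%SET| + 1)
                  (2 * #|[set i | (0 < s 0 i)%R]%SET| + 1)))%:R * b.
  rewrite /minn; case: ifP => _; [|case: ifP => _].
  - apply: spectral_sum_le_rank b0 eigH _.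
    have [a aE] : exists a : 'I_m -> 'I_r -> C,
        forall j : 'I_m, D ^+ j = \sum_t a j t *: D ^+ t.
      by have /fin_all_exists[a aE] := fun j : 'I_m => span j; exists a.
    (* Expanding [D^j] makes column [j] of [H] a combination of the [r] columns [h (i + t)], so [H]
       factors through dimension [r]. *)
    pose Z : 'M[C]_(m, r) := \matrix_(i, t) moment (i + t).
    pose W : 'M[C]_(r, m) := \matrix_(t, j) a j t.
    apply: (card_spectral_neq0 (Z := Z) (W := W) HH).
    apply/matrixP => i j; rewrite HE mxE /moment exprD (aE j).
    rewrite mulr_sumr mulmx_sumr mulmx_suml summxE; apply: eq_bigr => t _.
    rewrite -scalerAr -scalemxAr -scalemxAl [LHS]mxE [Z i t]mxE [W t j]mxE.
    by rewrite mulrC /moment exprD.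
  - apply: (@spectral_sum_le_inertia _ _ _ 1) => //; rewrite ?normr1 ?real1 //.
    apply: leq_trans (card_spectral_neg HH (erefl H) (real1 _) sR) _.
    by apply: eq_leq; congr #|pred_of_set _|; apply/setP => i; rewrite !inE mul1r.
  - apply: (@spectral_sum_le_inertia _ _ _ (-1)) => //;
      rewrite ?normrN1 ?realN ?real1 //.
    apply: leq_trans (card_spectral_neg HH (erefl H) (rpredN1 _) sR) _.
    apply: eq_leq; congr #|pred_of_set _|; apply/setP => i.
    by rewrite !inE mulN1r oppr_lt0.
apply: le_trans sumH.
(* Reverses [0, ..., k] and fixes the other indices, so as to be injective on all of ['I_m]; the
   [k + 1] selected entries all equal [h k]. *)
pose flip (i : 'I_m) : 'I_m :=
  if (i <= k)%N then Ordinal (leq_ltn_trans (leq_subr i k) km) else i.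
have flip_inj : injective flip.
  move=> i j /(congr1 val); rewrite /flip.
  by case: leqP => ik; case: leqP => jk /= ij; apply: val_inj => /=; lia.
have -> : k.+1%:R * `|moment k| = `|\sum_(i < m | (i <= k)%N) H i (flip i)|.
  rewrite (eq_bigr (fun=> moment k)) => [|i ik]; last first.
    by rewrite HE /flip ik /= subnKC.
  rewrite sumr_const -[in RHS]mulr_natl normrM normr_nat; congr (_%:R * _).
  rewrite -sum1_card (eq_bigl (fun i : 'I_m => (i < k.+1)%N)) //.
  by rewrite -(big_ord_widen _ (fun=> 1%N)) // sum1_card card_ord.
exact: hermitian_pairing_le.
Qed.
End SelfadjointMoments.

(** * Geometric bounds on powers from the spectrum *)

Section PowerDecay.
Context {C : numClosedFieldType} (n : nat).
Implicit Types (D : 'M[C]_n.+1) (v : 'cV[C]_n.+1).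

(** Induction on the linear factors: [y = (D - a) v] is annihilated by the remaining ones, and
    [D^(N+1) v = a D^N v + D^N y]. *)
Lemma vnorm_expr_le_roots D (rs : seq C) (r t : C) :
  0 <= r -> r < t -> (forall a, a \in rs -> `|a| <= r) ->
  forall v, horner_mx D (\prod_(a <- rs) ('X - a%:P)) *m v = 0 ->
  exists2 K, 0 <= K & forall N, vnorm (D ^+ N *m v) <= K * t ^+ N.
Proof.
move=> r0 rt; have t0 : 0 < t := le_lt_trans r0 rt.
have tr0 : 0 < t - r by rewrite subr_gt0.
elim: rs => [_ v|a rs IH rs_le v].
  rewrite big_nil rmorph1 mul1mx => ->; exists 0 => // N.
  by rewrite mulmx0 vnorm0 mul0r.
rewrite big_cons mulrC rmorphM /= => av0.
have {}IH := IH (fun b brs => rs_le b (mem_behead (s := a :: rs) brs)).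
pose y := horner_mx D ('X - a%:P) *m v.
have [|K K0 yK] := IH y; first by rewrite mulmxA.
have a_le : `|a| <= r by apply: rs_le; rewrite mem_head.
have DE N : D ^+ N.+1 *m v = a *: (D ^+ N *m v) + D ^+ N *m y.
  rewrite /y rmorphB /= horner_mx_X horner_mx_C mulmxBl mulmxBr mul_scalar_mx.
  by rewrite -scalemxAr addrC subrK exprSr -mulmxA.
(* For this constant [L], [t L - (r L + K) = (t - r) vnorm v] is nonnegative, which closes the
   induction on [N]. *)
exists (vnorm v + K / (t - r)).
  by rewrite addr_ge0 ?vnorm_ge0 ?divr_ge0 ?(ltW tr0).
elim=> [|N IHN].
  by rewrite !expr0 mul1mx mulr1 lerDl divr_ge0 ?(ltW tr0).
rewrite DE; apply: le_trans (vnormD _ _) _; rewrite vnormZ.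
apply: (@le_trans _ _ (r * ((vnorm v + K / (t - r)) * t ^+ N) + K * t ^+ N)).
  by rewrite lerD // ler_pM ?vnorm_ge0.
rewrite mulrA -mulrDl exprS mulrA ler_wpM2r ?exprn_ge0 ?(ltW t0) //.
rewrite -subr_ge0.
rewrite [X in 0 <= X](_ : _ = (t - r) * vnorm v); last first.
  by field; rewrite gt_eqF.
by rewrite mulr_ge0 ?vnorm_ge0 ?(ltW tr0).
Qed.

(** By Cayley-Hamilton the characteristic polynomial, whose roots are the eigenvalues, annihilates
    every [v]. *)
Lemma vnorm_expr_le D (r t : C) : 0 <= r -> r < t ->
  (forall a, eigenvalue D a -> `|a| <= r) ->
  forall v, exists2 K, 0 <= K & forall N, vnorm (D ^+ N *m v) <= K * t ^+ N.
Proof.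
move=> r0 rt Dr v; have [rs] := closed_field_poly_normal (char_poly D).
rewrite (monicP (char_poly_monic D)) scale1r => charE.
apply: (@vnorm_expr_le_roots _ rs r t) => // [a ars|].
  by apply: Dr; rewrite eigenvalue_root_char charE root_prod_XsubC.
by rewrite -charE Cayley_Hamilton mul0mx.
Qed.

End PowerDecay.

(** * Geometric decay over the complex numbers *)

Section ComplexGeometric.
Import numFieldNormedType.Exports.

(** A closed numeric field need not be archimedean, so this decay enters the general argument as a
    hypothesis and is proved here from the real limit. *)
Lemma complex_geometric_small (R : realType) (K d t : R[i]) k :
  0 <= K -> 0 < d -> 0 <= t -> t < 1 ->
  exists2 m, (k < m)%N & K * t ^+ (2 * m) < d.
Proof.
have toR (x : R[i]) : 0 <= x -> exists y : R, x = y%:C%C.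
  by move=> /ger0_real/complex_realP.
move=> K_ge0 d_gt0 t_ge0; have [K' KE] := toR K K_ge0.
have [d' dE] := toR d (ltW d_gt0); have [t' tE] := toR t t_ge0.
move: K_ge0 d_gt0 t_ge0; rewrite {}KE {}dE {}tE.
rewrite !lecR !ltcR => K0 d0 t0 t1.
have /cvgrPdist_lt/(_ (d' / (K' + 1)))[|m0 _ m0P] :
    ((fun i : nat => t' ^+ i) @ \oo --> (0 : R))%classic.
- by apply: cvg_expr; rewrite ger0_norm.
- by rewrite divr_gt0 // ltr_wpDl.
exists (maxn m0 k.+1); first exact: leq_maxr.
rewrite -rmorphXn -rmorphM ltcR.
have /= := m0P (2 * maxn m0 k.+1)%N; rewrite sub0r normrN ger0_norm ?exprn_ge0 //.
rewrite ltr_pdivlMr ?ltr_wpDl // mulrC => /(_ _)/(le_lt_trans _); apply.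
  by rewrite ler_wpM2r ?exprn_ge0 // lerDl.
by apply: leq_trans (leq_maxl m0 k.+1) _; rewrite leq_pmull.
Qed.

End ComplexGeometric.

(** * From moments to powers, after scaling by [rho] *)

Section PowerBound.
Context {C : numClosedFieldType} (n : nat).
Variables (s : 'rV[C]_n.+1) (B : 'M[C]_n.+1) (d : nat) (rho r0 M : C).
Let J := diag_mx s.
Hypothesis geometric_small : forall (K e t : C) k,
  0 <= K -> 0 < e -> 0 <= t -> t < 1 ->
  exists2 m, (k < m)%N & K * t ^+ (2 * m) < e.
Hypothesis s_sign : forall i, s 0 i = 1 \/ s 0 i = -1.
Hypothesis JB : B^t* *m J = J *m B.
Hypothesis rho_gt0 : 0 < rho.
Hypothesis M_ge0 : 0 <= M.
Hypothesis r0_lt : r0 < rho.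
Hypothesis eigenvalue_le : forall a, eigenvalue B a -> `|a| <= r0.
Hypothesis resolvent_le : forall (z : C) (x : 'cV_n.+1),
  `|z| = rho -> vnorm x <= M * vnorm (z *: x - B *m x).
Hypothesis span : forall j, exists a : 'I_d -> C, B ^+ j = \sum_t a t *: B ^+ t.

Let D := rho^-1 *: B.

Let c : C := (minn d (minn (2 * #|[set i | (s 0 i < 0)%R]%SET| + 1)
                           (2 * #|[set i | (0 < s 0 i)%R]%SET| + 1)))%:R.

Let rho_neq0 : rho != 0. Proof. exact: lt0r_neq0. Qed.

Let rho_norm : `|rho^-1| = rho^-1.
Proof. by rewrite ger0_norm // invr_ge0 ltW. Qed.

Let JD : D^t* *m J = J *m D.
Proof.
have rhoC : (rho^-1)^* = rho^-1 by apply/CrealP; rewrite ger0_real ?invr_ge0 ?ltW.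
rewrite /D linearZ /= -scalemxAr -JB scalemxAl; congr (_ *m _).
by rewrite map_mxZ; congr (_ *: _); exact: rhoC.
Qed.

(** On the unit circle the resolvent of [D] is bounded by [M rho]. The error term of [moment_le]
    vanishes as [m] grows, because the spectrum of [D] lies strictly inside the disc. *)
Lemma scaled_moment_le v k : k.+1%:R * `|moment s D v k| <=
  c * (M * rho) * vnorm v ^+ 2.
Proof.
have r0_ge0 : 0 <= r0.
  have [a aB] := eigenvalue_closed B (ltn0Sn n).
  exact: le_trans (normr_ge0 a) (eigenvalue_le aB).
have r_ge0 : 0 <= r0 / rho by rewrite divr_ge0 // ltW.
have r_lt1 : r0 / rho < 1 by rewrite ltr_pdivrMr // mul1r.
(* The midpoint [t] of [r0 / rho] and 1 is a decay rate above the spectrum of [D] and still below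
   1. *)
have [r_lt t_lt1] := midf_lt r_lt1; set t := (_ / 2) in r_lt t_lt1.
have D_le a : eigenvalue D a -> `|a| <= r0 / rho.
  move=> /eigenvalueP[x xD x0]; rewrite ler_pdivlMr //.
  rewrite -[X in _ * X](ger0_norm (ltW rho_gt0)) -normrM mulrC.
  apply/eigenvalue_le/eigenvalueP; exists x => //.
  by rewrite -scalerA -xD /D -scalemxAr scalerA divff // scale1r.
have D_res (z : C) (x : 'cV_n.+1) : `|z| = 1 ->
    vnorm x <= M * rho * vnorm (z *: x - D *m x).
  move=> z1; have zr : `|rho * z| = rho by rewrite normrM z1 mulr1 ger0_norm ?ltW.
  apply: le_trans (resolvent_le x zr) _; rewrite -mulrA ler_wpM2l //.
  rewrite -[X in X * vnorm _](ger0_norm (ltW rho_gt0)) -vnormZ scalerBr scalerA.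
  by rewrite /D -scalemxAl scalerA divff // scale1r.
have D_span j : exists a : 'I_d -> C, D ^+ j = \sum_t a t *: D ^+ t.
  have [a aE] := span j; exists (fun t => rho^-1 ^+ j * a t * rho ^+ t).
  rewrite /D exprZn aE scaler_sumr; apply: eq_bigr => i _.
  by rewrite exprZn !scalerA !exprVn mulfK // expf_neq0.
have Mrho : 0 <= M * rho by rewrite mulr_ge0 // ltW.
have [K K0 DK] := vnorm_expr_le r_ge0 r_lt D_le v.
have c_ge0 : 0 <= c by rewrite ler0n.
pose b := c * (M * rho * vnorm v).
have b0 : 0 <= b by rewrite !mulr_ge0 ?vnorm_ge0 // ltW.
apply/ler_addgt0Pr => e e0.
have [m km m_lt] := geometric_small k (mulr_ge0 b0 K0) e0
  (ltW (le_lt_trans r_ge0 r_lt)) t_lt1.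
apply: le_trans (moment_le s_sign JD Mrho D_res v km D_span) _; rewrite -/c.
rewrite mulrA -/b.
have -> : c * (M * rho) * vnorm v ^+ 2 = b * vnorm v by rewrite /b; ring.
apply: (@le_trans _ _ (b * (vnorm v + vnorm (D ^+ (2 * m) *m v)))).
  by rewrite ler_wpM2l // -(vnormN (D ^+ _ *m v)) vnormD.
rewrite mulrDr lerD2l; apply: le_trans (ltW m_lt); rewrite -[leRHS]mulrA.
exact: (ler_wpM2l b0 (DK _)).
Qed.

(** [J] is unitary and [J D^k] Hermitian, so bounds on the moments of all [v] bound the norm of
    [D^k]. *)
Theorem selfadjoint_power_le k (x : 'cV_n.+1) :
  k.+1%:R * vnorm (B ^+ k *m x) <= c * M * rho ^+ k.+1 * vnorm x.
Proof.
have k0 : 0 < k.+1%:R :> C by rewrite ltr0n.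
have b0 : 0 <= c * (M * rho) / k.+1%:R.
  by rewrite divr_ge0 ?ler0n // !mulr_ge0 ?ler0n // ltW.
have JDk : (J *m D ^+ k)^t* = J *m D ^+ k.
  rewrite trmx_mul map_mxM signature_herm //.
  exact: selfadjoint_expr.
have Dk : vnorm (D ^+ k *m x) <= c * (M * rho) / k.+1%:R * vnorm x.
  rewrite -(vnorm_unitary (D ^+ k *m x) (signature_unitary s_sign)) mulmxA.
  apply: hermitian_vnorm_le => // v.
  rewrite mulrAC ler_pdivlMr // mulrC.
  by have := scaled_moment_le v k; rewrite /moment !mulmxA.
have -> : B ^+ k = rho ^+ k *: D ^+ k.
  by rewrite /D exprZn scalerA -exprMn divff // expr1n scale1r.
rewrite -scalemxAl vnormZ ger0_norm ?exprn_ge0 ?(ltW rho_gt0) //.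
rewrite mulrCA.
have -> : c * M * rho ^+ k.+1 * vnorm x =
    rho ^+ k * (k.+1%:R * (c * (M * rho) / k.+1%:R * vnorm x)).
  by rewrite exprS; field; rewrite gt_eqF.
by rewrite ler_wpM2l ?exprn_ge0 ?(ltW rho_gt0) // ler_pM2l.
Qed.

End PowerBound.

(** * Reduction of the weighted norm to the Euclidean one *)

Section WeightedNorm.
Context {C : numClosedFieldType} (n : nat).
Variable G : 'M[C]_n.+1.
Hypothesis G_unit : G \in unitmx.
Hypothesis G_herm : G^t* = G.

Let U := spectralmx G.
Let l := spectral_diag G.
Let Uu : U^t* *m U = 1%:M := spectralmx_adjK G.

(** A left unitary multiple of the square root of [|G|], chosen so that the congruence takes [G] to
    a diagonal matrix of signs. *)
Definition gram_factor : 'M[C]_n.+1 :=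
  diag_mx (\row_i sqrtC `|l 0 i|) *m U.
Definition signature : 'rV[C]_n.+1 := \row_i (l 0 i / `|l 0 i|).

Let T := gram_factor.

Lemma spectral_diag_neq0 i : l 0 i != 0.
Proof.
apply/eqP => li0; move: G_unit; rewrite (hermitian_spectral G_herm) unitmxE.
rewrite !det_mulmx det_diag (bigD1 i) //= -/l li0 mul0r mulr0 mul0r.
by rewrite unitr0.
Qed.

Lemma signature_sign i : signature 0 i = 1 \/ signature 0 i = -1.
Proof.
rewrite mxE; have /real_neqr_lt := spectral_diag_real i G_herm.
move=> /(_ 0 (real0 _)); rewrite spectral_diag_neq0 -/l => /esym/orP[l0|l0].
  by right; rewrite ltr0_norm // invrN mulrN divff ?spectral_diag_neq0.
by left; rewrite gtr0_norm // divff ?spectral_diag_neq0.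
Qed.

Lemma signature_gt0 i : (0 < signature 0 i) = (0 < l 0 i).
Proof. by rewrite mxE pmulr_lgt0 // invr_gt0 normr_gt0 spectral_diag_neq0. Qed.

Lemma signature_lt0 i : (signature 0 i < 0) = (l 0 i < 0).
Proof. by rewrite mxE pmulr_llt0 // invr_gt0 normr_gt0 spectral_diag_neq0. Qed.

Lemma gram_factor_unit : T \in unitmx.
Proof.
rewrite unitmx_mul spectral_unit andbT unitmxE det_diag unitfE.
by apply/prodf_neq0 => i _; rewrite mxE sqrtC_eq0 normr_eq0 spectral_diag_neq0.
Qed.

Lemma gram_factorE : G = T^t* *m diag_mx signature *m T.
Proof.
rewrite {1}(hermitian_spectral G_herm) -/U /T /gram_factor trmx_mul map_mxM.
rewrite !mulmxA; congr (_ *m _); rewrite -!mulmxA; congr (_ *m _).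
rewrite tr_diag_mx map_diag_mx !mul_diag_mx; apply/matrixP => i j; rewrite !mxE.
have [->|ij] := eqVneq i j; last by rewrite !mulr0n !mulr0.
have sC : (sqrtC `|l 0 j|)^* = sqrtC `|l 0 j|.
  by apply/CrealP; rewrite ger0_real ?sqrtC_ge0.
rewrite !mulr1n.
transitivity (sqrtC `|l 0 j| * (l 0 j / `|l 0 j| * sqrtC `|l 0 j|)).
  by rewrite mulrCA -expr2 sqrtCK divfK // normr_eq0 spectral_diag_neq0.
congr (_ * _); exact: esym sC.
Qed.

(** [sqrtmx] diagonalizes [|G|] afresh, perhaps in another eigenbasis than that of [G]; both squared
    norms are therefore compared with the form of [|G|] at [x]. *)
Lemma vnorm_gram_factor (x : 'cV_n.+1) :
  vnorm (sqrtmx (absmx G) *m x) = vnorm (T *m x).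
Proof.
set P := absmx G.
have PE : P = U^t* *m diag_mx (map_mx (fun x => `|x|) l) *m U by [].
have PH : P^t* = P.
  rewrite PE !trmx_mul !map_mxM trmxCK tr_diag_mx map_diag_mx mulmxA.
  congr (_ *m diag_mx _ *m _); apply/rowP => i; rewrite !mxE.
  by apply/CrealP; rewrite ger0_real.
have Pform (y : 'cV_n.+1) :
    (y^t* *m P *m y) 0 0 = \sum_i `|l 0 i| * `|(U *m y) i 0| ^+ 2.
  rewrite PE !mulmxA -[y^t* *m U^t*]map_mxM -trmx_mul -mulmxA diag_form.
  by apply: eq_bigr => i _; rewrite mxE.
have P_ge0 i : 0 <= spectral_diag P 0 i.
  have [y _ <-] := spectral_eigen_form i PH; rewrite Pform; apply: sumr_ge0 => j _.
  by rewrite mulr_ge0 ?exprn_ge0.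
apply/eqP; rewrite -(@eqrXn2 _ 2) ?vnorm_ge0 //; apply/eqP.
transitivity ((x^t* *m P *m x) 0 0).
  rewrite spectral_form // /sqrtmx /hermfun -!mulmxA vnorm_unitary; last first.
    by rewrite trmxCK spectralmx_Kadj.
  rewrite vnorm_sqr; apply: eq_bigr => i _.
  rewrite mul_diag_mx !mxE normrM exprMn ger0_norm ?sqrtC_ge0 //.
  by rewrite sqrtCK.
rewrite Pform vnorm_sqr; apply: eq_bigr => i _.
rewrite /T /gram_factor -mulmxA mul_diag_mx !mxE normrM exprMn.
by rewrite ger0_norm ?sqrtC_ge0 // sqrtCK.
Qed.

(** The coefficients are those of the remainder of [X^j] modulo the minimal polynomial. *)
Lemma minpoly_degree_span (A : 'M[C]_n.+1) j :
  exists a : 'I_(minpoly_degree A) -> C, A ^+ j = \sum_t a t *: A ^+ t.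
Proof.
set d := minpoly_degree A; pose p := 'X^j %% mxminpoly A.
have p_d : (size p <= d)%N.
  by rewrite /d /minpoly_degree size_mxminpoly size_mod_mxminpoly.
exists (fun t => p`_t).
have -> : A ^+ j = horner_mx A p.
  rewrite -[A in LHS]horner_mx_X -rmorphXn {1}(divp_eq 'X^j (mxminpoly A)).
  by rewrite rmorphD rmorphM /= mx_root_minpoly mulr0 add0r.
have pE : p = \poly_(t < d) p`_t.
  apply/polyP => i; rewrite coef_poly; case: ltnP => // di.
  by rewrite nth_default // (leq_trans p_d).
rewrite [in LHS]pE poly_def raddf_sum; apply: eq_bigr => t _ /=.
by rewrite linearZ /= rmorphXn /= horner_mx_X.
Qed.

(** The similarity [B = S A S^-1] carries the norm, the self-adjointness, the spectrum, the
    resolvent bound and the span of powers over to the Euclidean setting. *)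
Theorem weighted_power_le (A : 'M[C]_n.+1) (p q : nat) (rho r0 M : C) :
  (forall (K e t : C) k, 0 <= K -> 0 < e -> 0 <= t -> t < 1 ->
    exists2 m, (k < m)%N & K * t ^+ (2 * m) < e) ->
  inertia G = (p, q) -> A^t* *m G = G *m A ->
  0 < rho -> 0 <= M -> r0 < rho ->
  (forall a, eigenvalue A a -> `|a| <= r0) ->
  (forall z x, `|z| = rho -> vnorm (sqrtmx (absmx G) *m x) <=
     M * vnorm (sqrtmx (absmx G) *m (z *: x - A *m x))) ->
  forall k x, k.+1%:R * vnorm (sqrtmx (absmx G) *m (A ^+ k *m x)) <=
    (minn (minpoly_degree A) (minn (2 * q + 1) (2 * p + 1)))%:R * M *
    rho ^+ k.+1 * vnorm (sqrtmx (absmx G) *m x).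
Proof.
move=> geo [pE qE] AG rho0 M0 r0rho Ar0 Ares k x.
have [S [Su GE SE]] : exists S : 'M[C]_n.+1, [/\ S \in unitmx,
    G = S^t* *m diag_mx signature *m S &
    forall y : 'cV_n.+1, vnorm (sqrtmx (absmx G) *m y) = vnorm (S *m y)].
  exists gram_factor; split; [exact: gram_factor_unit|exact: gram_factorE|].
  exact: vnorm_gram_factor.
have s_sign := signature_sign.
have neg_q : #|[set i | (signature 0 i < 0)%R]%SET| = q.
  by rewrite -qE; apply: eq_card => i; rewrite !inE signature_lt0.
have pos_p : #|[set i | (0 < signature 0 i)%R]%SET| = p.
  by rewrite -pE; apply: eq_card => i; rewrite !inE signature_gt0.
move: signature GE s_sign neg_q pos_p => s GE s_sign neg_q pos_p.
have [B BE] : exists B, B = S *m A *m invmx S by eexists.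
have BS : B *m S = S *m A by rewrite BE mulmxKV.
have BX j : B ^+ j = S *m A ^+ j *m invmx S.
  elim: j => [|j IHj]; first by rewrite !expr0 mulmx1 mulmxV.
  have -> : B ^+ j.+1 = B ^+ j *m B by rewrite exprSr.
  have -> : A ^+ j.+1 = A ^+ j *m A by rewrite exprSr.
  by rewrite IHj BE !mulmxA mulmxKV.
have JB : B^t* *m diag_mx s = diag_mx s *m B.
  have Ssu : S^t* \in unitmx by rewrite map_unitmx unitmx_tr.
  (* Multiplied by [S^t*] on the left and [S] on the right, the claim becomes the hypothesis
     [AG]. *)
  apply: (can_inj (mulKmx Ssu)); apply: (can_inj (mulmxK Su)).
  rewrite !mulmxA -[_ *m B *m S]mulmxA BS !mulmxA -GE -AG {1}GE !mulmxA.
  by rewrite -map_mxM -trmx_mul BS trmx_mul map_mxM.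
have Beig a : eigenvalue B a -> `|a| <= r0.
  move=> /eigenvalueP[y yB y0]; apply/Ar0/eigenvalueP; exists (y *m S).
    by rewrite -mulmxA -BS mulmxA yB scalemxAl.
  by apply: contraNneq y0 => yS; rewrite -(mulmxK Su y) yS mul0mx.
have Bres (z : C) (y : 'cV_n.+1) : `|z| = rho ->
    vnorm y <= M * vnorm (z *: y - B *m y).
  move=> zr; have := Ares z (invmx S *m y) zr; rewrite !SE mulKVmx //.
  rewrite mulmxBr -scalemxAr mulKVmx // mulmxA -BS -mulmxA mulKVmx //.
have Bspan j : exists a : 'I_(minpoly_degree A) -> C,
    B ^+ j = \sum_t a t *: B ^+ t.
  have [a aE] := minpoly_degree_span A j; exists a.
  rewrite BX aE mulmx_sumr mulmx_suml; apply: eq_bigr => t _.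
  by rewrite BX -scalemxAr -scalemxAl.
have := selfadjoint_power_le geo s_sign JB rho0 M0 r0rho Beig Bres Bspan
  k (S *m x).
rewrite BX !mulmxA mulmxKV // -mulmxA -!SE -mulmxA.
by rewrite neg_q pos_p.
Qed.

End WeightedNorm.

(** * Extended-real operator norms and Kreiss constants *)

Section ExtendedReals.
Variable R : realType.
Local Open Scope complex_scope.

Lemma norm2E n (x : 'cV[R[i]]_n) : (norm2 x)%:C = vnorm x.
Proof.
have s0 : 0 <= \sum_i Normc.normc (x i 0) ^+ 2.
  by apply: sumr_ge0 => i _; exact: sqr_ge0.
have n0 : 0 <= (norm2 x)%:C by rewrite lecR sqrtr_ge0.
apply/eqP; rewrite -(@eqrXn2 _ 2) ?vnorm_ge0 //.
rewrite vnorm_sqr -rmorphXn sqr_sqrtr // rmorph_sum; apply/eqP/eq_bigr => i _.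
by rewrite rmorphXn.
Qed.

Context (n : nat) (G : 'M[R[i]]_n.+1).
Hypothesis G_unit : G \in unitmx.
Hypothesis G_herm : G^t* = G.
Implicit Types (T A : 'M[R[i]]_n.+1) (x : 'cV[R[i]]_n.+1).

Lemma wnormE x : (wnorm G x)%:C = vnorm (sqrtmx (absmx G) *m x).
Proof. exact: norm2E. Qed.

Lemma wnorm_ge0 x : 0 <= wnorm G x.
Proof. exact: sqrtr_ge0. Qed.

Lemma wnorm_gt0 x : x != 0 -> 0 < wnorm G x.
Proof.
move=> x0; have : 0 < vnorm (gram_factor G *m x).
  rewrite lt0r vnorm_ge0 andbT vnorm_eq0; apply: contra_neq x0 => Tx.
  by rewrite -(mulKmx (gram_factor_unit G_unit G_herm) x) Tx mulmx0.
by rewrite -vnorm_gram_factor // -wnormE ltcR.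
Qed.

Lemma wopnorm_le T (t : R) :
  (forall x, wnorm G (T *m x) <= t * wnorm G x) -> (wopnorm G T <= t%:E)%E.
Proof.
move=> Tt; apply: ge_ereal_sup => _ [x /= x0 <-].
by rewrite lee_fin ler_pdivrMr ?wnorm_gt0.
Qed.

Lemma wopnorm_ge T (t : R) : (wopnorm G T <= t%:E)%E ->
  forall x, wnorm G (T *m x) <= t * wnorm G x.
Proof.
move=> Tt x; have [->|x0] := eqVneq x 0.
  have w0 : wnorm G 0 = 0.
    by apply: complexI; rewrite wnormE mulmx0 vnorm0.
  by rewrite mulmx0 w0 mulr0.
rewrite -ler_pdivrMr ?wnorm_gt0 // -lee_fin; apply: le_trans Tt.
by apply: ereal_sup_ubound; exists x.
Qed.

Lemma wopnorm_ge0 T : (0 <= wopnorm G T)%E.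
Proof.
have x0 : const_mx 1 != 0 :> 'cV[R[i]]_n.+1.
  by apply/eqP => /colP/(_ 0)/eqP; rewrite !mxE oner_eq0.
apply: (@le_trans _ _ (wnorm G (T *m const_mx 1) / wnorm G (const_mx 1))%:E).
  by rewrite lee_fin divr_ge0 ?wnorm_ge0.
by apply: ereal_sup_ubound; exists (const_mx 1).
Qed.

Lemma kreiss_at_ge0 (gamma : R) A : (0 <= kreiss_at gamma G A)%E.
Proof.
(* A point of modulus above [gamma], whatever the sign of [gamma]; one nonnegative term suffices. *)
pose z : R[i] := (`|gamma| + 1)%:C.
have nz : Normc.normc z = `|gamma| + 1.
  by apply: complexI; apply: ger0_norm; rewrite /z ler0c addr_ge0.
apply: (@le_trans _ _ ((Normc.normc z - gamma)%:E * wopnorm G (invmx (z%:M - A)))%E).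
  apply: mule_ge0; last exact: wopnorm_ge0.
  rewrite lee_fin nz subr_ge0.
  by rewrite (le_trans (ler_norm gamma)) // lerDl.
apply: ereal_sup_ubound; exists z => //.
change (is_true (gamma < Normc.normc z)); rewrite nz.
by rewrite (le_lt_trans (ler_norm gamma)) // ltrDl.
Qed.

(** [invmx] is a true inverse only off the spectrum, hence the condition on [z]. *)
Lemma kreiss_resolvent_le (gamma K : R) A (z : R[i]) x :
  kreiss_at gamma G A = K%:E -> gamma < Normc.normc z -> ~~ eigenvalue A z ->
  wnorm G x <= K / (Normc.normc z - gamma) * wnorm G (z *: x - A *m x).
Proof.
move=> KE gz zA; have gz0 : 0 < Normc.normc z - gamma by rewrite subr_gt0.
have zA_unit : z%:M - A \in unitmx.
  move: zA; rewrite /eigenvalue negbK => /eqP kz.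
  rewrite -opprB -scaleN1r unitmxZ ?unitrN1 // -row_free_unit -kermx_eq0.
  exact/eqP.
have zAx : (z%:M - A) *m x = z *: x - A *m x by rewrite mulmxBl mul_scalar_mx.
rewrite -zAx -{1}(mulKmx zA_unit x); apply: wopnorm_ge.
rewrite -(@lee_pmul2l _ (Normc.normc z - gamma)%:E) ?lte_fin //.
rewrite -EFinM mulrCA divff ?gt_eqF // mulr1 -KE.
by apply: ereal_sup_ubound; exists z.
Qed.

Variables (q : nat) (A : 'M[R[i]]_n.+1).
Hypothesis G_inertia : inertia G = ((n.+1 - q)%N, q).
Hypothesis AG : A^t* *m G = G *m A.

Let c : R := (minn (minpoly_degree A)
  (minn (2 * q + 1)%N (2 * (n.+1 - q) + 1)%N))%:R.

(** On [|z| = rho] the resolvent is at most [K / (rho - gamma)]; [rho] stays free, to be chosen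
    according to [k]. *)
Lemma wopnorm_expr_le (gamma rho K : R) k : 0 <= gamma -> gamma < rho ->
  (forall a, eigenvalue A a -> Normc.normc a <= gamma) ->
  kreiss_at gamma G A = K%:E ->
  (wopnorm G (A ^+ k) <=
     (c * (K / (rho - gamma)) * rho ^+ k.+1 / k.+1%:R)%:E)%E.
Proof.
move=> g0 gr Ag KE; have K0 : 0 <= K.
  by rewrite -lee_fin -KE kreiss_at_ge0.
have rho0 := le_lt_trans g0 gr.
have M0 : 0 <= K / (rho - gamma) by rewrite divr_ge0 // subr_ge0 ltW.
have Ares (z : R[i]) x : `|z| = rho%:C ->
    vnorm (sqrtmx (absmx G) *m x) <=
    (K / (rho - gamma))%:C * vnorm (sqrtmx (absmx G) *m (z *: x - A *m x)).
  move=> /complexI zr; rewrite -!wnormE -rmorphM lecR -zr.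
  apply: kreiss_resolvent_le => //; first by rewrite zr.
  by apply/negP => /Ag; rewrite zr leNgt gr.
have := weighted_power_le G_unit G_herm (@complex_geometric_small R)
  G_inertia AG
  (rho := rho%:C) (r0 := gamma%:C) (M := (K / (rho - gamma))%:C).
rewrite !lecR !ltcR => /(_ rho0 M0 gr _ Ares) H.
apply: wopnorm_le => x; have {H} := H _ k x.
rewrite -!wnormE -(rmorph_nat (real_complex R)).
rewrite -(rmorph_nat (real_complex R) (minn _ _)).
rewrite -rmorphXn -!rmorphM lecR -/c => H.
rewrite mulrAC ler_pdivlMr ?ltr0n // mulrC; apply: H => a /Ag.
by rewrite -lecR.
Qed.

End ExtendedReals.

(** * Spectral radius, choice of the radius, and conclusion *)

Section FinalBounds.
Variable R : realType.

Lemma normc_ge0 (z : R[i]) : 0 <= Normc.normc z.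
Proof. by case: z => a b; exact: sqrtr_ge0. Qed.

(** The supremum dominates its set only if the set is bounded; the sum of the moduli of the roots of
    the characteristic polynomial is a bound. *)
Lemma eigenvalue_le_spectral_radius n (A : 'M[R[i]]_n) a :
  eigenvalue A a -> Normc.normc a <= spectral_radius A.
Proof.
move=> Aa; apply: ub_le_sup; last by exists a.
have [rs] := closed_field_poly_normal (char_poly A).
rewrite (monicP (char_poly_monic A)) scale1r => charE.
exists (\sum_(b <- rs) Normc.normc b) => _ [b /= Ab <-].
have brs : b \in rs by rewrite -root_prod_XsubC -charE -eigenvalue_root_char.
rewrite (big_rem b brs) /= lerDl; apply: sumr_ge0 => d _.
exact: normc_ge0.
Qed.

Lemma compound_le_expR k : (0 < k)%N -> (1 + k%:R^-1) ^+ k <= expR 1 :> R.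
Proof.
move=> k0; have -> : expR 1 = expR (k%:R^-1) ^+ k :> R.
  by rewrite -expRM_natl divff // pnatr_eq0 -lt0n.
by rewrite lerXn2r ?nnegrE ?expR_ge0 ?expR_ge1Dx ?addr_ge0 ?invr_ge0.
Qed.

End FinalBounds.

Theorem corollary6p3 (R : realType) (n q : nat) (G A : 'M[R[i]]_n.+1)
  (G_unit : G \in unitmx) (G_herm : G^t* = G)
  (G_inertia : inertia G = ((n.+1 - q)%N, q))
  (AG : A^t* *m G = G *m A) :
  let c : R :=
    (minn (minpoly_degree A)
          (minn (2 * q + 1)%N (2 * (n.+1 - q) + 1)%N))%:R in
  (spectrum A `<=` [set z | `|z| <= 1] ->
     (power_bound G A <= (expR 1 * c)%:E * kreiss G A)%E) /\
  (forall gamma : R, spectral_radius A < gamma -> gamma < 1 ->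
     forall k : nat, (1 <= k)%N ->
       (wopnorm G (A ^+ k) <=
          (c * (1 + k%:R^-1) ^+ k)%:E * kreiss_at gamma G A * (gamma ^+ k)%:E)%E /\
       (wopnorm G (A ^+ k) <=
          (expR 1 * c)%:E * kreiss_at gamma G A * (gamma ^+ k)%:E)%E).
Proof.
(* Positivity of [c] is what makes the bounds infinite when the Kreiss constant is. *)
move=> c; have c_gt0 : 0 < c.
  rewrite ltr0n !leq_min !addn1 !andbT /minpoly_degree size_mxminpoly.
  exact: mxminpoly_nonconstant.
have e_gt0 : 0 < expR 1 :> R := expR_gt0 1.
have bound (gamma K : R) k : 0 < gamma -> (0 < k)%N ->
    (forall a, eigenvalue A a -> Normc.normc a <= gamma) ->
    kreiss_at gamma G A = K%:E ->
    (wopnorm G (A ^+ k) <= (c * (1 + k%:R^-1) ^+ k * K * gamma ^+ k)%:E)%E.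
  move=> g0 k0 Ag KE; have kR : 0 < k%:R :> R by rewrite ltr0n.
  (* The radius [gamma (1 + 1/k)] minimizes [rho^(k+1) / (rho - gamma)], and the bound becomes
     [c K (1 + 1/k)^k gamma^k]. *)
  have grho : gamma < gamma * (1 + k%:R^-1).
    by rewrite mulrDr mulr1 ltrDl divr_gt0.
  have := wopnorm_expr_le G_unit G_herm G_inertia AG k (ltW g0) grho Ag KE.
  rewrite -/c; congr (_ <= _%:E)%E.
  rewrite !exprMn !exprS -natr1; field.
  have -> : gamma * (k%:R + 1) + - gamma * k%:R = gamma by ring.
  by rewrite natr1 pnatr_eq0 !gt_eqF.
have finite_or_pinfty gamma :
    kreiss_at gamma G A = +oo%E \/ exists2 K, 0 <= K & kreiss_at gamma G A = K%:E.
  have := kreiss_at_ge0 G gamma A.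
  by case: (kreiss_at gamma G A) => [K K0|_|//]; [right; exists K|left].
split=> [Asp|gamma gA _ k k1].
  have Ag a : eigenvalue A a -> Normc.normc a <= 1.
    by move=> /Asp /=; rewrite -lecR.
  rewrite /kreiss; have [->|[K K0 KE]] := finite_or_pinfty 1.
    by rewrite mulry gtr0_sg ?mulr_gt0 // mul1e leey.
  apply: ge_ereal_sup => _ [k _ <-]; rewrite KE -EFinM.
  have [->|k0] := posnP k.
    (* At [k = 0] the radius above is undefined; [rho = 2] gives [2 c K], and [2 <= e]. *)
    have := wopnorm_expr_le G_unit G_herm G_inertia AG 0 ler01 (ltr1n R 2) Ag KE.
    move=> /le_trans; apply; rewrite lee_fin -/c.
    have e_ge2 : 2 <= expR 1 :> R by have := expR_ge1Dx (1 : R).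
    have -> : c * (K / (2 - 1)) * 2 ^+ 1 / 1 = 2 * (c * K).
      have -> : 2 - 1 = 1 :> R by ring.
      by field.
    by rewrite -mulrA ler_wpM2r // mulr_ge0 // ltW.
  apply: le_trans (bound 1 K k ltr01 k0 Ag KE) _.
  rewrite lee_fin expr1n mulr1 ler_wpM2r // mulrC ler_wpM2r ?(ltW c_gt0) //.
  exact: compound_le_expR.
have Ag a : eigenvalue A a -> Normc.normc a <= gamma.
  by move=> /eigenvalue_le_spectral_radius/le_trans; apply; apply: ltW.
(* Some eigenvalue exists, so the spectral radius is nonnegative and [gamma] is positive. *)
have g0 : 0 < gamma.
  have [a aA] := eigenvalue_closed A (ltn0Sn n).
  apply: le_lt_trans gA; apply: le_trans (eigenvalue_le_spectral_radius aA).
  exact: normc_ge0.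
have gk0 : 0 < gamma ^+ k by rewrite exprn_gt0.
have ck0 : 0 < c * (1 + k%:R^-1) ^+ k.
  by rewrite mulr_gt0 // exprn_gt0 // ltr_pwDl ?invr_ge0.
have [->|[K K0 KE]] := finite_or_pinfty gamma.
  split; rewrite mulry gtr0_sg ?mulr_gt0 // mul1e mulyr gtr0_sg // mul1e leey //.
have le1 := bound gamma K k g0 k1 Ag KE.
rewrite KE -!EFinM; split=> //; apply: le_trans le1 _.
rewrite lee_fin ler_wpM2r ?(ltW gk0) // ler_wpM2r // mulrC.
by rewrite ler_wpM2r ?(ltW c_gt0) // compound_le_expR.
Qed.
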